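(* Let $k,n$ be integers with $4\le k<n$ and $n\ge 30$, and suppose that $n$ divides $\binom{n}{k}$. Then the complete $k$-uniform hypergraph $K_n^{(k)}$ on $n$ vertices has a decomposition into Hamilton Berge cycles, i.e. its edge set can be partitioned into the edge sets of Hamilton Berge cycles.
   Context: $K_n^{(k)}$ is the $k$-uniform hypergraph on an $n$-element vertex set whose edges are all $k$-element subsets of the vertex set. A Berge cycle is an alternating sequence $v_1,e_1,v_2,e_2,\dots,v_n,e_n$ of distinct vertices $v_i$ and distinct edges $e_i$ such that each $e_i$ contains $v_i$ and $v_{i+1}$ (indices modulo $n$, so $e_n$ contains $v_n$ and $v_1$). It is a Hamilton Berge cycle of a hypergraph $G$ if $\{v_1,\dots,v_n\}$ is the whole vertex set of $G$ and every $e_i$ is an edge of $G$; thus it has exactly $n$ edges. A decomposition of a hypergraph into Hamilton Berge cycles is a collection of Hamilton Berge cycles whose edge sets are pairwise disjoint and together cover all edges. *)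

(* Defs.v *)
From mathcomp Require Import all_boot.

Set Implicit Arguments.
Unset Strict Implicit.
Unset Printing Implicit Defensive.

(* A hypergraph on the finite vertex type V is given by its edge set,
   of type {set {set V}}. *)
Definition complete_hypergraph (V : finType) (k : nat) : {set {set V}} :=
  [set e : {set V} | #|e| == k].

(* The alternating sequence v_1, e_1, ..., v_m, e_m is encoded as the sequence
   of pairs [:: (v_1, e_1); ...; (v_m, e_m)]. *)
Definition cycle_vertices (V : finType) (c : seq (V * {set V})) : {set V} :=
  [set:: unzip1 c].

Definition cycle_edges (V : finType) (c : seq (V * {set V})) : {set {set V}} :=
  [set:: unzip2 c].

(* [cycle r c] asks for r between consecutive items and also between the last
   item and the first, i.e. v_i, v_{i+1} \in e_i with indices modulo m. *)
Definition berge_cycle (V : finType) (c : seq (V * {set V})) : bool :=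
  [&& uniq (unzip1 c), uniq (unzip2 c) &
      cycle (fun p q : V * {set V} => (p.1 \in p.2) && (q.1 \in p.2)) c].

Definition hamilton_berge_cycle (V : finType) (G : {set {set V}})
    (c : seq (V * {set V})) : bool :=
  [&& berge_cycle c, cycle_vertices c == [set: V] & cycle_edges c \subset G].

(* [pairwise] compares entries at distinct positions, so a cycle repeated in D
   is not disjoint from its other occurrence. *)
Definition hamilton_berge_decomposition (V : finType) (G : {set {set V}})
    (D : seq (seq (V * {set V}))) : bool :=
  [&& all (hamilton_berge_cycle G) D,
      pairwise (fun c c' => [disjoint cycle_edges c & cycle_edges c']) D &
      \bigcup_(c <- D) cycle_edges c == G].

(* Main.v *)
Require Import Defs.
From mathcomp Require Import all_boot zify.

(** Write [n = N + 1]. The zigzag Hamilton path on the residues modulo [N],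
    closed up through a point at infinity, has [N] translates that cover every
    pair of vertices exactly twice. Take [m = 'C(n, k) / n] of these cycles,
    using each translate either [m %/ N] or [m %/ N + 1] times; their positions
    are as numerous as the k-sets, and a perfect matching of positions with
    k-sets containing the two vertices at the position is a decomposition.
    Hall's condition is checked as follows. For [k >= n - 3] every position
    fits at least half of the k-sets and every k-set at least half of the
    positions. For [k <= n - 4] let [G] be the graph of the pairs missed by a
    set of positions. By normalized matching the density of k-cliques of [G]
    is at most that of its 4-cliques. A 4-clique splits into two disjoint
    edges, so there are at most [#|G| ^ 2 / 6] of them, which suffices when
    [G] has at most half of all pairs. Otherwise the set [B] of spanned pairs
    is small, and most 4-sets containing one of its edges do not contain
    all six. *)

Set Implicit Arguments.
Unset Strict Implicit.
Unset Printing Implicit Defensive.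

(** * Hall's marriage theorem *)

(** Induction on the total size of the sets [N x]: while some [N x] has two elements, one of them
    can be deleted without breaking Hall's condition; once all are singletons, the condition on
    two-element sets is injectivity. *)
Lemma hall_marriage (P K : finType) (N : P -> {set K}) :
  (forall A : {set P}, #|A| <= #|\bigcup_(x in A) N x|) ->
  exists f : P -> K, injective f /\ forall x, f x \in N x.
Proof.
have [s] := ubnP (\sum_x #|N x|); elim: s N => // s IHs N ltNs hallN.
have N_gt0 x : 0 < #|N x| by have := hallN [set x]; rewrite big_set1 cards1.
have [/existsP[x N_gt1] | /existsPn N_le1] := boolP [exists x, 1 < #|N x|].
  have /card_gt1P[y1 [y2 [Ny1 Ny2 y12]]] := N_gt1.
  pose N' y z := if z == x then N x :\ y else N z.
  have N'sub y z : N' y z \subset N z.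
    by rewrite /N'; case: eqP => [->|_]; rewrite ?subD1set.
  pose halls y := [forall A : {set P}, #|A| <= #|\bigcup_(z in A) N' y z|].
  have reduce y : y \in N x -> halls y ->
      exists f : P -> K, injective f /\ forall x, f x \in N x.
    move=> Ny /forallP hally.
    have [|f [injf Nf]] := IHs (N' y) _ hally.
      rewrite ltnS in ltNs; apply: leq_trans ltNs; rewrite [leqRHS](bigD1 x) //= (bigD1 x) //=.
      rewrite {1}/N' eqxx (cardsD1 y (N x)) Ny add1n addSn ltnS leq_add2l.
      by apply: leq_sum => z _; apply: subset_leq_card.
    by exists f; split=> // z; apply: subsetP (N'sub y z) _ (Nf z).
  have [/(reduce _ Ny1)//|/forallPn[A1]] := boolP (halls y1).
  have [/(reduce _ Ny2)//|/forallPn[A2]] := boolP (halls y2).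
  rewrite -!ltnNge => lt2 lt1.
  (* Only [N x] shrinks, so a set violating Hall's condition after the deletion contains [x]. *)
  have xA y (A : {set P}) : #|\bigcup_(z in A) N' y z| < #|A| -> x \in A.
    move=> ltA; apply: contraLR ltA => xA; rewrite -leqNgt.
    rewrite (eq_bigr N) // => z zA; rewrite /N' ifN //.
    by apply: contraNneq xA => <-.
  have {xA}[xA1 xA2] := (xA _ _ lt1, xA _ _ lt2).
  (* The sets [N(A1 :|: A2)] and [N((A1 :&: A2) :\ x)] contradict submodularity. *)
  have := cardsUI (\bigcup_(z in A1) N' y1 z) (\bigcup_(z in A2) N' y2 z).
  have subU : \bigcup_(z in A1 :|: A2) N z \subset
      (\bigcup_(z in A1) N' y1 z) :|: (\bigcup_(z in A2) N' y2 z).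
    apply/bigcupsP => z zA; apply/subsetP => w Nzw; rewrite inE.
    have [zx | zx] := eqVneq z x; last first.
      move: zA; rewrite inE => /orP[] zA; apply/orP; [left | right];
        by apply/bigcupP; exists z; rewrite // /N' ifN.
    rewrite zx in Nzw; have [wy1 | wy1] := eqVneq w y1; apply/orP;
      [right | left]; apply/bigcupP; exists x; rewrite // /N' eqxx !inE Nzw andbT //.
    by rewrite wy1.
  have subI : \bigcup_(z in (A1 :&: A2) :\ x) N z \subset
      (\bigcup_(z in A1) N' y1 z) :&: (\bigcup_(z in A2) N' y2 z).
    apply/bigcupsP => z; rewrite !inE => /and3P[zx zA1 zA2].
    apply/subsetP => w Nzw; rewrite inE; apply/andP.
    by split; apply/bigcupP; exists z; rewrite // /N' ifN.
  have := leq_trans (hallN _) (subset_leq_card subU).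
  have := leq_trans (hallN _) (subset_leq_card subI).
  have := cardsUI A1 A2; have := cardsD1 x (A1 :&: A2).
  rewrite !inE xA1 xA2; lia.
pose f x := xchoose (card_gt0P (N_gt0 x)).
have Nf x : f x \in N x by apply: xchooseP.
exists f; split=> // x y fxy; apply/eqP/negPn/negP => xy.
have Nx1 z : N z = [set f z].
  apply/esym/eqP; rewrite eqEcard sub1set Nf cards1 leqNgt.
  exact: N_le1.
have := hallN [set x; y]; rewrite cards2 xy bigcup_setU !big_set1.
by rewrite !Nx1 fxy setUid cards1.
Qed.

(** * Zigzag Hamilton cycles *)

(** The path [N, 1, N - 1, 2, ...], with [N] standing for the residue 0; its successive differences
    modulo [N] are 1, -2, 3, -4 and so on. *)
Definition zigzag N i := if odd i then i.+1./2 else N - i./2.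

Lemma zigzag_bounds N i : i < N -> 0 < zigzag N i <= N.
Proof. rewrite /zigzag; case: ifP; lia. Qed.

Lemma zigzag_inj N i j : i < N -> j < N -> zigzag N i = zigzag N j -> i = j.
Proof. rewrite /zigzag; do 2![case: ifP]; lia. Qed.

Lemma zigzag_step N i : i.+1 < N ->
  if odd i then zigzag N i.+1 + i.+1 = N + zigzag N i
  else zigzag N i + i.+1 = N + zigzag N i.+1.
Proof. rewrite /zigzag /=; case: (odd i) (odd_double_half i) => /=; lia. Qed.

Lemma modn_lt_double N t : t < N + N ->
  (t < N /\ t %% N = t) \/ (N <= t /\ t %% N = t - N).
Proof.
move=> lt_t; have [lt_tN | le_Nt] := ltnP t N; [left | right]; split=> //.
  exact: modn_small.
by rewrite -{1}(subnK le_Nt) modnDr modn_small; lia.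
Qed.

(* [i < N] indexes the translated zigzag path; [N] is the point at infinity. *)
Definition zigzag_vertex N c i := if i < N then (zigzag N i + c) %% N else N.

Lemma zigzag_vertexP N c i : c < N -> i < N ->
  zigzag_vertex N c i < N /\
  (zigzag_vertex N c i = zigzag N i + c \/
   zigzag_vertex N c i + N = zigzag N i + c).
Proof.
move=> ltc lti; rewrite /zigzag_vertex lti.
have := zigzag_bounds lti; have := @modn_lt_double N (zigzag N i + c); lia.
Qed.

Lemma zigzag_vertex_oo N c : zigzag_vertex N c N = N.
Proof. by rewrite /zigzag_vertex ltnn. Qed.

Lemma zigzag_vertex_inj N c i j : c < N -> i <= N -> j <= N ->
  zigzag_vertex N c i = zigzag_vertex N c j -> i = j.
Proof.
move=> ltc; rewrite (leq_eqVlt i) (leq_eqVlt j).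
case/orP=> [/eqP->|lti] /orP[/eqP->|ltj]; rewrite ?zigzag_vertex_oo //.
- by have := zigzag_vertexP ltc ltj; lia.
- by have := zigzag_vertexP ltc lti; lia.
move=> eqv; apply: (zigzag_inj lti ltj).
have := zigzag_vertexP ltc lti; have := zigzag_vertexP ltc ltj.
have := zigzag_bounds lti; have := zigzag_bounds ltj; lia.
Qed.

(* Edges avoiding infinity are oriented so that the head of edge [i] is its tail
   plus [i.+1] modulo [N]: the ordered pair then determines [i], and hence [c]. *)
Definition zigzag_arc N c i :=
  let u := zigzag_vertex N c i in let v := zigzag_vertex N c (i.+1 %% N.+1) in
  if odd i && (i.+1 < N) then (v, u) else (u, v).

Lemma zigzag_arc_finite N c i : c < N -> i.+1 < N ->
  let: (u, v) := zigzag_arc N c i in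
  [/\ u < N, v < N & u + i.+1 = v \/ u + i.+1 = v + N].
Proof.
move=> ltc ltSi; have lti := ltnW ltSi.
rewrite /zigzag_arc ltSi andbT modn_small; last by lia.
have [ltu equ] := zigzag_vertexP ltc lti.
have [ltv eqv] := zigzag_vertexP ltc ltSi.
have := zigzag_step ltSi; case: (odd i) => /= step; split=> //; lia.
Qed.

(** The point [N] is the tail of the last arc, the head of the one before it, and on no other arc.
    On the others the difference gives [i]. In each case a finite endpoint then gives the
    translation [c]. *)
Lemma zigzag_arc_inj N c d i j : c < N -> d < N -> i <= N -> j <= N ->
  zigzag_arc N c i = zigzag_arc N d j -> c = d /\ i = j.
Proof.
move=> ltc ltd lei lej eqa.
have arc_last b : zigzag_arc N b N = (N, zigzag_vertex N b 0).
  by rewrite /zigzag_arc ltnNge leqnSn andbF modnn zigzag_vertex_oo.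
have arc_penult b i0 : i0.+1 = N -> zigzag_arc N b i0 = (zigzag_vertex N b i0, N).
  move=> <-; rewrite /zigzag_arc ltnn andbF modn_small //.
  by rewrite zigzag_vertex_oo.
have eqc : i < N -> i = j ->
    zigzag_vertex N c i = zigzag_vertex N d j -> c = d /\ i = j.
  move=> lti eij; subst j; have := zigzag_vertexP ltc lti.
  have := zigzag_vertexP ltd lti; lia.
have N0 : 0 < N by lia.
have kind a : a <= N -> [\/ a = N, a.+1 = N | a.+1 < N].
  move=> lea; case: (ltngtP a.+1 N) => ?;
    [constructor 3 | constructor 1 | constructor 2]; lia.
case: (kind i lei) => [ei|ei|lti]; case: (kind j lej) => [ej|ej|ltj].
- subst i j; move: eqa; rewrite !arc_last => -[].
  have := zigzag_vertexP ltc N0; have := zigzag_vertexP ltd N0; lia.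
- subst i; move: eqa; rewrite arc_last (arc_penult d j) // => -[].
  have := @zigzag_vertexP N d j ltd; lia.
- subst i; move: eqa; rewrite arc_last => eqa.
  have := zigzag_arc_finite ltd ltj; rewrite -eqa => -[]; lia.
- subst j; move: eqa; rewrite arc_last (arc_penult c i) // => -[].
  have := @zigzag_vertexP N c i ltc; lia.
- move: eqa; rewrite (arc_penult c i) // (arc_penult d j) // => -[].
  apply: eqc; lia.
- move: eqa; rewrite (arc_penult c i) // => eqa.
  have := zigzag_arc_finite ltd ltj; rewrite -eqa => -[]; lia.
- subst j; move: eqa; rewrite arc_last => eqa.
  have := zigzag_arc_finite ltc lti; rewrite eqa => -[]; lia.
- move: eqa; rewrite (arc_penult d j) // => eqa.
  have := zigzag_arc_finite ltc lti; rewrite eqa => -[]; lia.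
have := zigzag_arc_finite ltc lti; have := zigzag_arc_finite ltd ltj.
rewrite -eqa; case E: (zigzag_arc N c i) => [u v] [ltu ltv Hj] [_ _ Hi].
have eij : i = j by lia.
subst j; apply: eqc => //; first by lia.
move: eqa; rewrite /zigzag_arc lti andbT.
by case: ifP => _ [].
Qed.

(** [arc] orients the edges of all [N] cycles so that no ordered pair repeats. Hence a pair of
    vertices occurs at most twice and, there being [N * N.+1] positions, exactly twice. *)
Lemma zigzag_hamilton_cycles (N : nat) (V : finType) (cardV : #|V| = N.+1) :
  exists (C : 'I_N -> 'I_N.+1 -> V) (arc : 'I_N * 'I_N.+1 -> V * V),
  [/\ forall c, injective (C c), injective arc &
      forall p, (arc p).1 != (arc p).2 /\
        [set (arc p).1; (arc p).2] = [set C p.1 p.2; C p.1 (ordS p.2)]].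
Proof.
pose g (a : 'I_N.+1) : V := enum_val (cast_ord (esym cardV) a).
have g_inj : injective g by move=> a b /enum_val_inj/cast_ord_inj.
have vertex_lt (c : 'I_N) i : zigzag_vertex N c i < N.+1.
  have [lti | lei] := ltnP i N; last by rewrite /zigzag_vertex ifN // -leqNgt.
  by have [ltv _] := zigzag_vertexP (ltn_ord c) lti; apply: ltnW.
pose h a : V := g (inord a).
have h_inj a b : a < N.+1 -> b < N.+1 -> h a = h b -> a = b.
  by move=> lta ltb /g_inj/(congr1 val); rewrite /= !inordK.
pose C (c : 'I_N) (i : 'I_N.+1) := h (zigzag_vertex N c i).
have C_inj c : injective (C c).
  move=> i j /h_inj eqv; apply/val_inj/(zigzag_vertex_inj (ltn_ord c)).
  - exact: (ltn_ord i).
  - exact: (ltn_ord j).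
  - by apply: eqv.
pose arc (p : 'I_N * 'I_N.+1) : V * V :=
  let a := zigzag_arc N p.1 p.2 in (h a.1, h a.2).
have arc_lt (p : 'I_N * 'I_N.+1) :
    ((zigzag_arc N p.1 p.2).1 < N.+1) /\ ((zigzag_arc N p.1 p.2).2 < N.+1).
  by rewrite /zigzag_arc; case: ifP => _; split; apply: vertex_lt.
exists C, arc; split=> // [p q [/h_inj e1 /h_inj e2] | p].
  have [] : (p.1 : nat) = q.1 /\ (p.2 : nat) = q.2.
    have [[p1N p2N] [q1N q2N]] := (arc_lt p, arc_lt q).
    apply: (@zigzag_arc_inj N); rewrite // -1?ltnS //.
    by apply/eqP; rewrite -pair_eqE /pair_eq e1 // e2 // !eqxx.
  by case: p q {e1 e2} => [p1 p2] [q1 q2] /= /val_inj-> /val_inj->.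
have Cne : C p.1 p.2 != C p.1 (ordS p.2).
  rewrite (inj_eq (C_inj _)); apply/eqP => /(congr1 val)/=.
  have [lti | lei] := ltnP p.2 N; first by rewrite modn_small; lia.
  by have := ltn_ord p.2; have := ltn_ord p.1 => ltN lti;
    have -> : p.2 = N :> nat by [lia]; rewrite modnn; lia.
rewrite /arc /zigzag_arc; case: ifP => _ /=; split=> //.
  by rewrite eq_sym.
by rewrite setUC.
Qed.

(** * Counting pairs, subsets and supersets *)

Lemma card_ordered_pairs (V : finType) (B : {set {set V}}) :
  #|[set p : V * V | (p.1 != p.2) && ([set p.1; p.2] \in B)]| <= 2 * #|B|.
Proof.
set A := [set p | _].
rewrite -sum1_card (partition_big (fun p : V * V => [set p.1; p.2]) (mem B)).
  rewrite mulnC -sum_nat_const; apply: leq_sum => e _.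
  rewrite -[X in X <= _](eq_bigl _ _ (fun p => in_set _ p)) sum1_card.
  have [-> | [[a b]]] := set_0Vmem [set p in A | [set p.1; p.2] == e].
    by rewrite cards0.
  rewrite !inE /= => /andP[/andP[ab _] /eqP <-].
  apply: leq_trans (_ : #|[set (a, b); (b, a)]| <= _); last first.
    by rewrite cards2; case: (_ != _).
  apply/subset_leq_card/subsetP => -[u v]; rewrite !inE /=.
  case/andP=> /andP[uv _] /eqP/setP E.
  have := E u; have := E v; rewrite !inE !eqxx /= orbT => /esym ev /esym eu.
  rewrite -!pair_eqE /pair_eq /=; move: ev eu uv.
  by do 2![case/orP=> /eqP->]; rewrite ?eqxx // ?orbT.
by move=> p; rewrite inE => /andP[].
Qed.

Lemma mul_bin_bin j k n : j <= k -> k <= n ->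
  'C(n, k) * 'C(k, j) = 'C(n, j) * 'C(n - j, k - j).
Proof.
move=> lejk lekn.
have F : 0 < j`! * (k - j)`! * (n - k)`! by rewrite !muln_gt0 !fact_gt0.
apply/eqP; rewrite -(eqn_pmul2r F); apply/eqP.
have := bin_fact lejk; have := bin_fact lekn.
have := bin_fact (leq_trans lejk lekn).
have := @bin_fact (n - j) (k - j) (leq_sub2r _ lekn).
have -> : n - j - (k - j) = n - k by lia.
move=> E1 E2 E3 E4; transitivity n`!; first by rewrite -E3 -E4; lia.
by rewrite -E2 -E1; lia.
Qed.

(** Binomial coefficients grow up to the middle; a [k] past it is reflected to [n - k], which is
    still at least [j]. *)
Lemma leq_bin_unimodal j k n : j <= k -> k + j <= n -> 'C(n, j) <= 'C(n, k).
Proof.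
have half i d : i <= d -> d.*2 <= n -> 'C(n, i) <= 'C(n, d).
  move=> /subnK <-; elim: (d - i) => // t IHt; rewrite addSn => le_n.
  apply: leq_trans (IHt _) _; first by lia.
  rewrite -(leq_pmul2l (ltn0Sn (t + i))) mul_bin_left leq_mul2r; apply/orP; right.
  lia.
move=> lejk lekn; have [le2k | lt2k] := leqP k.*2 n; first exact: half.
by rewrite -(@bin_sub n k) ?half //; lia.
Qed.

Lemma double_count (X Y : finType) (A : {set X}) (B : {set Y}) (r : X -> Y -> bool) :
  \sum_(x in A) #|[set y in B | r x y]| = \sum_(y in B) #|[set x in A | r x y]|.
Proof.
have E (Z : finType) (D : {set Z}) (s : pred Z) :
    #|[set z in D | s z]| = \sum_(z in D) s z.
  rewrite -sum1_card big_mkcond [RHS]big_mkcond; apply: eq_bigr => z _.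
  by rewrite inE; case: (z \in D); case: (s z).
under eq_bigr do rewrite E; under [RHS]eq_bigr do rewrite E.
exact: exchange_big.
Qed.

Lemma card_supersets (V : finType) (A : {set V}) k : #|A| <= k ->
  #|[set e in complete_hypergraph V k | A \subset e]| = 'C(#|V| - #|A|, k - #|A|).
Proof.
move=> leAk; have -> : #|V| - #|A| = #|~: A| by rewrite [RHS]cardsCs setCK.
rewrite -cards_draws.
rewrite -(@card_in_imset _ _ (fun e => e :\: A) [set e in _ | _]).
  apply: eq_card => d; rewrite !inE; apply/imsetP/andP.
    move=> [e]; rewrite !inE => /andP[/eqP ek Ae] ->; split.
      by rewrite setDE subsetIr.
    by rewrite cardsD (setIidPr Ae) ek.
  move=> [dA /eqP dk]; have dIA : A :&: d = set0.
    by apply/disjoint_setI0; rewrite disjoint_sym disjoints_subset.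
  exists (A :|: d).
    by rewrite !inE subsetUl cardsU dIA cards0 dk subn0 subnKC ?eqxx.
  rewrite setDUl setDv set0U; apply/esym/setDidPl.
  by rewrite disjoints_subset.
move=> e f; rewrite !inE => /andP[_ Ae] /andP[_ Af] eqD.
by rewrite -(setID e A) -(setID f A) eqD (setIidPr Ae) (setIidPr Af).
Qed.

Lemma card_subsets_of (V : finType) (e : {set V}) j :
  #|[set d in complete_hypergraph V j | d \subset e]| = 'C(#|e|, j).
Proof. by rewrite -cards_draws; apply: eq_card => d; rewrite !inE andbC. Qed.

(** * Cliques and hit sets *)

Definition cliques (V : finType) (k : nat) (G : {set {set V}}) : {set {set V}} :=
  [set e in complete_hypergraph V k |
    [set d in complete_hypergraph V 2 | d \subset e] \subset G].

(** When [B] is the set of pairs at some positions, this is the neighbourhood of those positions in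
    Hall's condition. *)
Definition hits (V : finType) (k : nat) (B : {set {set V}}) : {set {set V}} :=
  [set e in complete_hypergraph V k | [exists d in B, d \subset e]].

Lemma card_hits_cliques (V : finType) k (B : {set {set V}}) :
  B \subset complete_hypergraph V 2 ->
  #|hits k B| + #|cliques k (complete_hypergraph V 2 :\: B)| = 'C(#|V|, k).
Proof.
move=> subB; rewrite -card_draws -/(complete_hypergraph V k).
rewrite -(cardsID (hits k B) (complete_hypergraph V k)); congr (_ + _).
  by apply: eq_card => e; rewrite !inE; case: (#|e| == k).
apply: eq_card => e; rewrite !inE; case: (#|e| == k); rewrite ?andbF //= andbT.
apply/subsetP/existsPn => [sub d | sub d].
  apply/negP=> /andP[dB de].
  by have := sub d; have := subsetP subB d dB; rewrite !inE dB de => -> /(_ isT).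
by rewrite !inE => /andP[-> de]; rewrite andbT; have := sub d; rewrite de andbT.
Qed.

(** Every [k]-clique contains ['C(k, j)] cliques of size [j], and every [j]-set lies in
    ['C(#|V| - j, k - j)] of the [k]-sets; [mul_bin_bin] turns this double count into densities. *)
Lemma cliques_local_lym (V : finType) j k (G : {set {set V}}) : j <= k ->
  k <= #|V| ->
  #|cliques k G| * 'C(#|V|, j) <= #|cliques j G| * 'C(#|V|, k).
Proof.
move=> lejk lekn.
have count : #|cliques k G| * 'C(k, j) <= #|cliques j G| * 'C(#|V| - j, k - j).
  rewrite -!sum_nat_const.
  have -> : \sum_(e in cliques k G) 'C(k, j) =
      \sum_(e in cliques k G) #|[set d in cliques j G | d \subset e]|.
    apply: eq_bigr => e; rewrite !inE => /andP[/eqP ek /subsetP eG].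
    rewrite -{1}ek -card_subsets_of; apply: eq_card => d; rewrite !inE.
    case: (boolP (d \subset e)) => de; rewrite ?andbF ?andbT //.
    case: (#|d| == j) => //=; apply/esym/subsetP => p; rewrite !inE.
    by move=> /andP[p2 pd]; apply: eG; rewrite !inE p2 (subset_trans pd).
  rewrite double_count; apply: leq_sum => d; rewrite inE => /andP[].
  rewrite inE => /eqP dj _; rewrite -dj -card_supersets ?dj //.
  apply/subset_leq_card/subsetP => e; rewrite !inE.
  by case/andP=> /andP[-> _] ->.
have bins := mul_bin_bin lejk lekn.
have kj0 : 0 < 'C(k, j) by rewrite bin_gt0.
rewrite -(leq_pmul2r kj0) mulnAC -(mulnA #|cliques j G|) bins.
by rewrite (mulnC 'C(#|V|, j)) mulnA leq_mul2r count orbT.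
Qed.

Lemma card_cliques4 (V : finType) (G : {set {set V}}) :
  6 * #|cliques 4 G| <= #|G| ^ 2.
Proof.
rewrite mulnC -mulnn -cardsX.
pose S := [set p : {set V} * {set V} |
  [&& p.1 \in cliques 4 G, #|p.2| == 2 & p.2 \subset p.1]].
have -> : #|cliques 4 G| * 6 = #|S|.
  rewrite -sum_nat_const -[RHS]sum1_card.
  rewrite (eq_bigl (fun p : {set V} * {set V} => (p.1 \in cliques 4 G) &&
     (p.2 \in [set d in complete_hypergraph V 2 | d \subset p.1]))); last first.
    by move=> p; rewrite !inE.
  rewrite -(pair_big_dep (fun e => e \in cliques 4 G)
    (fun e d => d \in [set d in complete_hypergraph V 2 | d \subset e])
    (fun _ _ => 1)) /=.
  apply: eq_bigr => e; rewrite inE => /andP[]; rewrite inE => /eqP e4 _.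
  by rewrite sum1_card card_subsets_of e4.
(* A 4-clique is determined by one of its 6 edges and the complementary edge. *)
rewrite -(@card_in_imset _ _ (fun p => (p.2, p.1 :\: p.2)) S).
  apply/subset_leq_card/subsetP => x /imsetP[[e d]]; rewrite !inE /=.
  case/and3P=> /andP[/eqP e4 /subsetP eG] d2 de ->; apply/andP; split => /=.
    by apply: eG; rewrite !inE d2.
  apply: eG; rewrite !inE subsetDl cardsD (setIidPr de) e4.
  by rewrite (eqP d2).
move=> [e d] [e' d']; rewrite !inE /= => /and3P[_ _ de] /and3P[_ _ de'] [ed eqD].
rewrite ed in de eqD *; congr (_, _).
by rewrite -(setID e d') -(setID e' d') eqD (setIidPr de) (setIidPr de').
Qed.

(* A 4-set spanning an edge of [B] spans at most 5 of them unless it is a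
   clique, so double counting loses little. *)
Lemma card_hits4 (V : finType) (B : {set {set V}}) :
  B \subset complete_hypergraph V 2 ->
  6 * 'C(#|V| - 2, 2) * #|B| <= 30 * #|hits 4 B| + #|B| ^ 2.
Proof.
move=> subB; apply: leq_trans (leq_add (leqnn _) (card_cliques4 B)).
suff : #|B| * 'C(#|V| - 2, 2) <= 5 * #|hits 4 B| + #|cliques 4 B| by lia.
have -> : #|B| * 'C(#|V| - 2, 2) =
    \sum_(d in B) #|[set e in complete_hypergraph V 4 | d \subset e]|.
  rewrite -sum_nat_const; apply: eq_bigr => d dB.
  have /eqP d2 : #|d| == 2 by have := subsetP subB d dB; rewrite inE.
  by rewrite card_supersets d2.
rewrite double_count [5 * _]mulnC -sum_nat_const -[#|cliques _ _|]sum1_card.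
rewrite [X in X <= _]big_mkcond [X in _ <= X + _]big_mkcond.
rewrite [X in _ <= _ + X]big_mkcond -big_split /=; apply: leq_sum => e _; rewrite !inE.
have [/eqP e4 | //] := boolP (#|e| == 4).
have sub2 : [set d in B | d \subset e] \subset
    [set d in complete_hypergraph V 2 | d \subset e].
  by apply/subsetP => d; rewrite !inE => /andP[/(subsetP subB)]; rewrite inE => ->.
have card2 : #|[set d in complete_hypergraph V 2 | d \subset e]| = 6.
  by rewrite card_subsets_of e4.
have le6 := subset_leq_card sub2; rewrite card2 in le6.
have [ex | /existsPn none] := boolP [exists d in B, d \subset e].
  rewrite /=; case: ifP => [_ | nclq]; first by rewrite (leq_trans le6).
  rewrite addn0 -ltnS ltn_neqAle le6 andbT.
  apply: contraFN nclq => /eqP card6.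
  suff <- : [set d in B | d \subset e] =
      [set d in complete_hypergraph V 2 | d \subset e].
    by apply/subsetP => d; rewrite inE => /andP[].
  by apply/eqP; rewrite eqEcard sub2 card2 card6.
by rewrite eq_card0 // => d; rewrite !inE (negbTE (none d)).
Qed.

(** * Hall's condition for [k <= n - 4] *)

Lemma double_bin2 n : 2 * 'C(n, 2) = n * n.-1.
Proof. by rewrite -mul_bin_diag bin1. Qed.

(** [D], [M], [N4], [Nk] stand for ['C(n - 2, 2)], ['C(n, 2)], ['C(n, 4)], ['C(n, k)]; [f] and [f4]
    count the hit [k]-sets and 4-sets, and [b] is [#|B|]. With [D = b + s], [f] is at least
    [Nk b / M + Nk s b / (5 M D)]. The first term is at least [2 q b]; as [M D <= 6 Nk], taking
    [s >= 60] makes the second at least [2 b]. *)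
Lemma few_pairs_arith D M N4 Nk f f4 b q :
  6 * N4 = M * D -> N4 <= Nk -> b + 60 <= D -> 0 < M ->
  6 * D * b <= 30 * f4 + b * b -> Nk * f4 <= f * N4 -> 2 * q * M <= Nk ->
  2 * q.+1 * b <= f.
Proof.
move=> N4D leN4 leD M0 f4b lym qlo; rewrite leqNgt; apply/negP => ltf.
have b0 : 0 < b by case: b ltf {leD f4b} => //; rewrite muln0.
have [s Ds s60] : exists2 s, D = b + s & 60 <= s by exists (D - b); lia.
have E1 : Nk * (6 * D * b) <= Nk * (30 * f4 + b * b) by rewrite leq_mul2l f4b orbT.
have E2 : 5 * (M * D) * f < 5 * (M * D) * (2 * q.+1 * b).
  by rewrite ltn_pmul2l //; nia.
have E3 : 2 * q * M * (5 * D * b) <= Nk * (5 * D * b) by rewrite leq_mul2r qlo orbT.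
have E4 : 60 * (Nk * b) <= s * (Nk * b) by rewrite leq_mul2r s60 orbT.
have E5 : M * D * b <= 6 * Nk * b by rewrite leq_mul2r -N4D leq_mul2l leN4 !orbT.
have E6 : f * (6 * N4) = f * (M * D) by rewrite N4D.
have E7 : Nk * b * D = Nk * b * (b + s) by rewrite Ds.
lia.
Qed.

(** Here [x] and [x4] count the cliques of the [g] missed pairs. With [D = g + s], [x] is at most
    [Nk g / M - Nk s g / (M D)]. The first term is at most [2 (q + 1) g], and [s >= 60] makes the
    subtracted one at least [10 g]. *)
Lemma many_pairs_arith D M N4 Nk x x4 g q :
  6 * N4 = M * D -> N4 <= Nk -> g + 60 <= D -> 0 < M ->
  6 * x4 <= g * g -> x * N4 <= x4 * Nk -> Nk <= 2 * q.+1 * M ->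
  x <= 2 * q * g.
Proof.
move=> N4D leN4 leD M0 x4g lym qhi; rewrite leqNgt; apply/negP => ltx.
have [s Ds s60] : exists2 s, D = g + s & 60 <= s by exists (D - g); lia.
have E1 : Nk * (6 * x4) <= Nk * (g * g) by rewrite leq_mul2l x4g orbT.
have E2 : M * D * (2 * q * g) < M * D * x by rewrite ltn_pmul2l //; nia.
have E3 : Nk * (D * g) <= 2 * q.+1 * M * (D * g) by rewrite leq_mul2r qhi orbT.
have E4 : 60 * (Nk * g) <= s * (Nk * g) by rewrite leq_mul2r s60 orbT.
have E5 : M * D * g <= 6 * Nk * g by rewrite leq_mul2r -N4D leq_mul2l leN4 !orbT.
have E6 : x * (6 * N4) = x * (M * D) by rewrite N4D.
have E7 : Nk * g * D = Nk * g * (g + s) by rewrite Ds.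
lia.
Qed.

(* Here [a] is the size of a set of positions spanning the pairs in [B], and
   every pair occurs between [2 * q] and [2 * q.+1] times. *)
Lemma hits_ge_sparse (V : finType) k (B : {set {set V}}) q a :
  4 <= k -> k + 4 <= #|V| -> 30 <= #|V| -> B \subset complete_hypergraph V 2 ->
  2 * q * 'C(#|V|, 2) <= 'C(#|V|, k) -> 'C(#|V|, k) <= 2 * q.+1 * 'C(#|V|, 2) ->
  a <= 2 * q.+1 * #|B| ->
  a + 2 * q * #|complete_hypergraph V 2 :\: B| <= 'C(#|V|, k) ->
  a <= #|hits k B|.
Proof.
move=> k4 kn n30 subB.
have lekn : k <= #|V| by lia.
have := cliques_local_lym (complete_hypergraph V 2 :\: B) k4 lekn.
have := card_cliques4 (complete_hypergraph V 2 :\: B).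
have := card_hits4 subB; have := card_hits_cliques k subB.
have := card_hits_cliques 4 subB.
have := cardsID B (complete_hypergraph V 2); rewrite (setIidPr subB).
rewrite card_draws.
have n4 : 4 <= #|V| by lia.
have := @mul_bin_bin 2 4 #|V| isT n4; have := leq_bin_unimodal k4 kn.
have := double_bin2 #|V|; have := double_bin2 (#|V| - 2).
move: #|_ :\: B| #|cliques 4 _| #|cliques k _| #|hits k B| #|hits 4 B| #|B|.
move=> g x4 x f f4 b.
rewrite -!mulnn; move: 'C(#|V| - 2, 2) 'C(#|V|, 2) 'C(#|V|, 4) 'C(#|V|, k).
move=> D M N4 Nk D2 M2 leN4; have -> : 'C(4, 2) = 6 by [].
move=> N4D bg hits4 hitsk hits4_ge clq4 lym qlo qhi aB aG.
(* By [n >= 30]; whichever of [b] and [g] is at most [M / 2] is then at least 60 below [D]. *)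
have DM : M + 120 <= 2 * D by nia.
have M0 : 0 < M by nia.
have N4D' : 6 * N4 = M * D by rewrite mulnC.
have [leb | ltb] := leqP b.*2 M.
  apply: leq_trans aB _; apply: (few_pairs_arith N4D' leN4 _ M0 hits4_ge _ qlo); first by lia.
  (* Complements turn the density bound for cliques into the reverse bound for hits. *)
  have : f4 * Nk + x4 * Nk = N4 * Nk by rewrite -mulnDl hits4.
  have : f * N4 + x * N4 = Nk * N4 by rewrite -mulnDl hitsk.
  lia.
(* The [k]-sets not hit are the [x] cliques of missed pairs, so [f >= Nk - 2 * q * g >= a]. *)
have : x <= 2 * q * g by apply: (many_pairs_arith N4D' leN4 _ M0 clq4 lym qhi); lia.
lia.
Qed.

(** * Cyclic positions, and Hall's condition for [k >= n - 3] *)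

Lemma cycleP_nth (T : Type) (r : rel T) (x0 : T) (s : seq T) :
  (forall i, i < size s -> r (nth x0 s i) (nth x0 s (i.+1 %% size s))) ->
  cycle r s.
Proof.
case: s => //= x p rs; apply/(pathP x0) => i; rewrite size_rcons => lti.
have := rs i lti; rewrite -rcons_cons (nth_rcons x0 (x :: p)) /= lti nth_rcons.
have [ltip | leip] := ltnP i (size p); first by rewrite modn_small.
have -> : i = size p by lia.
by rewrite modnn /= eqxx.
Qed.

Lemma cycle_ordS n (T : Type) (r : rel T) (g : 'I_n -> T) :
  (forall i, r (g i) (g (ordS i))) -> cycle r [seq g i | i <- enum 'I_n].
Proof.
case: n g => [|n] g rg; first by rewrite (size0nil (size_enum_ord 0)).
apply: (@cycleP_nth _ _ (g ord0)) => i; rewrite size_map size_enum_ord => lti.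
rewrite !(nth_map ord0 (g ord0) g) ?size_enum_ord ?ltn_pmod //.
have -> : nth ord0 (enum 'I_n.+1) (i.+1 %% n.+1) =
    ordS (nth ord0 (enum 'I_n.+1) i).
  by apply: val_inj; rewrite /= !nth_enum_ord // ltn_pmod.
exact: rg.
Qed.

Definition edge_at (V : finType) m n (C : 'I_m -> 'I_n -> V) (p : 'I_m * 'I_n) :=
  [set C p.1 p.2; C p.1 (ordS p.2)].

Lemma card_edge_at (V : finType) m n (C : 'I_m -> 'I_n -> V) p :
  1 < n -> (forall j, injective (C j)) -> #|edge_at C p| = 2.
Proof.
move=> n1 injC; rewrite cards2 (inj_eq (injC _)).
suff -> : p.2 != ordS p.2 by [].
apply/eqP => /(congr1 val) /=; have [lt | ge] := ltnP p.2.+1 n.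
  by rewrite modn_small //; lia.
have -> : p.2.+1 = n by have := ltn_ord p.2; lia.
by rewrite modnn; have := ltn_ord p.2; lia.
Qed.

(** A vertex outside [e] spoils at most two places, the one it starts and the one it ends. *)
Lemma card_edges_within (V : finType) n (v : 'I_n -> V) (e : {set V}) :
  injective v ->
  n <= #|[set i | [set v i; v (ordS i)] \subset e]| + 2 * #|~: e|.
Proof.
move=> injv; have injS : injective (v \o @ordS n) by apply/inj_comp/ordS_inj.
have := cardsCs [set i | [set v i; v (ordS i)] \subset e]; rewrite card_ord.
suff : #|~: [set i | [set v i; v (ordS i)] \subset e]| <= 2 * #|~: e| by lia.
apply: leq_trans (_ : #|(v @^-1: (~: e)) :|: ((v \o @ordS n) @^-1: (~: e))| <= _).
  apply/subset_leq_card/subsetP => i.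
  by rewrite !inE subUset !sub1set negb_and.
rewrite cardsU (leq_trans (leq_subr _ _)) // mul2n -addnn leq_add //.
  by rewrite -(card_imset _ injv) subset_leq_card // sub_imset_pre.
by rewrite -(card_imset _ injS) subset_leq_card // sub_imset_pre.
Qed.

(* Here every position fits at least half of the k-sets and vice versa. *)
Lemma hits_ge_dense (V : finType) k m n (C : 'I_m -> 'I_n -> V)
    (A : {set 'I_m * 'I_n}) :
  #|V| = n -> 30 <= n -> k < n -> n <= k + 3 -> m * n = 'C(n, k) ->
  (forall j, injective (C j)) -> #|A| <= #|hits k (edge_at C @: A)|.
Proof.
move=> Vn n30 kn nk mn injC.
have [leA | ltA] := leqP (2 * #|A|) (m * n).
  have [-> | [p pA]] := set_0Vmem A; first by rewrite cards0.
  have card2 : #|edge_at C p| = 2 by apply: card_edge_at => //; lia.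
  (* A single pair lies in this many [k]-sets, at least half of them all because
     ['C(n, 2) <= 2 * 'C(k, 2)]. *)
  apply: leq_trans (_ : 'C(n - 2, k - 2) <= _); last first.
    have := @card_supersets V (edge_at C p) k; rewrite card2 Vn => <-; last by lia.
    apply/subset_leq_card/subsetP => e; rewrite !inE => /andP[-> pe] /=.
    by apply/existsP; exists (edge_at C p); rewrite imset_f.
  have k2 : 2 <= k by lia.
  have := mul_bin_bin k2 (ltnW kn); rewrite -mn.
  have := double_bin2 k; have := double_bin2 n; have := bin_gt0 n 2.
  move: 'C(n, 2) 'C(k, 2) 'C(n - 2, k - 2) => M K Z M0 M2 K2 E.
  rewrite leqNgt; apply/negP => ltZ.
  have leMK : M <= 2 * K by nia.
  have F1 : M * Z < M * #|A| by rewrite ltn_pmul2l //; lia.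
  have F2 : 2 * #|A| * K <= m * n * K by rewrite leq_mul2r leA orbT.
  have F3 : M * #|A| <= 2 * K * #|A| by rewrite leq_mul2r leMK orbT.
  lia.
(* [A] now holds more than half of the positions. A [k]-set misses at most 3 vertices, so it fits at
   least [n - 6] positions on each cycle, and some of these are in [A]. *)
suff -> : hits k (edge_at C @: A) = complete_hypergraph V k.
  by have := max_card (mem A); rewrite card_prod !card_ord card_draws Vn mn.
apply/setP => e; rewrite !inE; have [/eqP ek | //] := boolP (#|e| == k).
have ce : #|~: e| = n - k by rewrite cardsCs setCK Vn ek.
pose W : {set 'I_m * 'I_n} := [set p | edge_at C p \subset e].
have cW : m * n <= #|W| + m * (2 * (n - k)).
  have -> : #|W| = \sum_(j < m) #|[set i | [set C j i; C j (ordS i)] \subset e]|.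
    rewrite -sum1_card (eq_bigl (fun p => true && (edge_at C (p.1, p.2) \subset e))).
      rewrite -(pair_big_dep predT (fun j i => edge_at C (j, i) \subset e)
                  (fun _ _ => 1)) /=.
      by apply: eq_bigr => j _; rewrite sum1dep_card.
    by move=> [j i]; rewrite inE.
  have const a : m * a = \sum_(j < m) a by rewrite sum_nat_const card_ord.
  rewrite !const -big_split; apply: leq_sum => j _ /=.
  by rewrite -ce; apply: card_edges_within.
have : 0 < #|A :&: W|.
  have := cardsUI A W.
  have : #|A :|: W| <= m * n.
    by have := max_card (mem (A :|: W)); rewrite card_prod !card_ord.
  have : m * (2 * (n - k)) <= m * 6 by rewrite leq_mul2l; lia.
  have : m * 30 <= m * n by rewrite leq_mul2l n30 orbT.
  lia.
case/card_gt0P => p; rewrite !inE => /andP[pA pW].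
by apply/existsP; exists (edge_at C p); rewrite imset_f.
Qed.

(** * Repeating translates, and assembling the decomposition *)

(** Cycle [j] will be translate [j %% N]. The numbers [c + t * N] with [t < m %/ N] give the lower
    bound; for the upper one, the quotient [j %/ N] determines [j] within its class. *)
Lemma card_residue_class N m (c : 'I_N) :
  m %/ N <= #|[set j : 'I_m | j %% N == c]| <= (m %/ N).+1.
Proof.
have ltc := ltn_ord c; have N0 : 0 < N by lia.
apply/andP; split.
  have lt_t (t : 'I_(m %/ N)) : c + t * N < m.
    have := ltn_ord t; have := leq_divM m N; nia.
  pose F t := Ordinal (lt_t t).
  have injF : injective F.
    move=> s t /(congr1 val) /= /addnI /eqP; rewrite eqn_pmul2r // => /eqP.
    exact: val_inj.
  rewrite -{1}(card_ord (m %/ N)) -cardsT -(card_imset _ injF).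
  apply/subset_leq_card/subsetP => j /imsetP[t _ ->].
  by rewrite inE /= addnC modnMDl modn_small.
pose F (j : 'I_m) : 'I_(m %/ N).+1 := inord (j %/ N).
rewrite -[leqRHS]card_ord -(@card_in_imset _ _ F); first exact: max_card.
move=> i j; rewrite !inE => /eqP iN /eqP jN /(congr1 val) /=.
rewrite !inordK ?ltnS ?leq_div2r ?(ltnW (ltn_ord _)) // => ij.
by apply: val_inj; rewrite /= (divn_eq i N) (divn_eq j N) ij iN jN.
Qed.

Lemma card_reindexed (N m n : nat) (c : 'I_m -> 'I_N) q (S : {set 'I_N * 'I_n}) :
  (forall d, q <= #|[set j | c j == d]| <= q.+1) ->
  q * #|S| <= #|[set p : 'I_m * 'I_n | (c p.1, p.2) \in S]| <= q.+1 * #|S|.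
Proof.
move=> cq; set T := [set p | _].
have -> : #|T| = \sum_(s in S) #|[set j | c j == s.1]|.
  rewrite -sum1_card (partition_big (fun p => (c p.1, p.2)) (mem S)) /=; last first.
    by move=> p; rewrite inE.
  apply: eq_bigr => -[d i] sS; rewrite sum1dep_card.
  have inj_i : injective (fun j : 'I_m => (j, i)) by move=> x y [].
  rewrite -(card_imset _ inj_i); apply: eq_card => -[j i0].
  rewrite !inE /=; apply/andP/imsetP => [[_ /eqP[<- ->]] | [j0]].
    by exists j; rewrite ?inE.
  by rewrite inE => /eqP cj [-> ->]; rewrite cj.
have constE r : r * #|S| = \sum_(s in S) r by rewrite sum_nat_const mulnC.
by rewrite !constE; apply/andP; split; apply: leq_sum => s _; case/andP: (cq s.1).
Qed.

(** [f (j, i)] becomes the [i]-th hyperedge of cycle [j]. Injectivity makes hyperedges distinct and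
    cycles disjoint; with as many positions as [k]-sets, it also makes [f] onto. *)
Lemma decomposition_of_matching (V : finType) k m n (C : 'I_m -> 'I_n -> V)
    (f : 'I_m * 'I_n -> {set V}) :
  #|V| = n -> m * n = 'C(n, k) -> (forall j, injective (C j)) ->
  injective f -> (forall p, f p \in complete_hypergraph V k) ->
  (forall p, edge_at C p \subset f p) ->
  exists D, hamilton_berge_decomposition (complete_hypergraph V k) D.
Proof.
move=> Vn mn injC injf fk Cf.
pose cyc j := [seq (C j i, f (j, i)) | i <- enum 'I_n].
have edgesE j : cycle_edges (cyc j) = [set f (j, i) | i : 'I_n].
  rewrite /cycle_edges /unzip2 -map_comp; apply/setP => e; rewrite inE.
  apply/mapP/imsetP => [[i _ ->] | [i _ ->]]; exists i; rewrite ?inE //.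
  by rewrite mem_enum.
have fim : [set f p | p : 'I_m * 'I_n] = complete_hypergraph V k.
  apply/eqP; rewrite eqEcard card_imset // card_prod !card_ord card_draws Vn mn.
  by rewrite leqnn andbT; apply/subsetP => e /imsetP[p _ ->].
exists [seq cyc j | j <- enum 'I_m]; apply/and3P; split.
- apply/allP => _ /mapP[j _ ->].
  have vertsE : unzip1 (cyc j) = [seq C j i | i <- enum 'I_n].
    by rewrite /unzip1 -map_comp.
  apply/and3P; split; last 1 first.
  + by rewrite edgesE; apply/subsetP => e /imsetP[i _ ->].
  + apply/and3P; split.
    * by rewrite vertsE map_inj_uniq ?enum_uniq.
    * rewrite /unzip2 -map_comp map_inj_uniq ?enum_uniq //.
      by move=> i i' /injf[].
    * apply: cycle_ordS => i /=.
      by have := Cf (j, i); rewrite subUset !sub1set.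
  + apply/eqP/setP => v; rewrite !inE vertsE.
    have [|g _ Cg] := inj_card_bij (injC j); first by rewrite card_ord Vn.
    by rewrite -(Cg v) map_f // mem_enum.
- rewrite pairwise_map; have := enum_uniq 'I_m; rewrite uniq_pairwise.
  apply: sub_pairwise => j j' /= jj'; rewrite !edgesE.
  apply/pred0P => e /=; apply/andP => -[/imsetP[i _ ->] /imsetP[i' _ /injf[]]].
  by move/eqP; rewrite (negbTE jj').
rewrite big_map big_enum /=; apply/eqP; rewrite -fim.
apply/setP => e; apply/bigcupP/imsetP => [[j _] | [[j i] _ ->]].
  by rewrite edgesE => /imsetP[i _ ->]; exists (j, i).
by exists j; rewrite // edgesE imset_f.
Qed.

Theorem theorem1p1 (k n : nat) (V : finType) (cardV : #|V| = n)
    (k_ge4 : 4 <= k) (k_lt_n : k < n) (n_ge30 : 30 <= n)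
    (n_dvd : n %| 'C(n, k)) :
  exists D : seq (seq (V * {set V})),
    hamilton_berge_decomposition (complete_hypergraph V k) D.
Proof.
case: n cardV k_lt_n n_ge30 n_dvd => // N cardV ltkn n30 n_dvd.
have N0 : 0 < N by lia.
have [C [arc [injC injarc arcE]]] := zigzag_hamilton_cycles cardV.
set n := N.+1 in cardV ltkn n30 n_dvd C arc injC injarc arcE *.
pose m := 'C(n, k) %/ n; have mn : m * n = 'C(n, k) by rewrite divnK.
pose c (j : 'I_m) := Ordinal (ltn_pmod j N0).
pose C' j := C (c j).
have injC' j : injective (C' j) by apply: injC.
have edgeE p : edge_at C' p = edge_at C (c p.1, p.2) by [].
suff hallC (A : {set 'I_m * 'I_n}) : #|A| <= #|hits k (edge_at C' @: A)|.
  have [A | f [injf fP]] := @hall_marriage _ _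
      (fun p => [set e in complete_hypergraph V k | edge_at C' p \subset e]).
    apply: leq_trans (hallC A) (subset_leq_card _).
    apply/subsetP => e; rewrite !inE => /andP[ek /existsP[d /andP[]]].
    case/imsetP=> p pA -> pe; apply/bigcupP; exists p => //.
    by rewrite !inE ek.
  apply: (@decomposition_of_matching V k m n C' f) => // p;
    by have := fP p; rewrite inE => /andP[].
have [kn | nk] := leqP (k + 4) n; last first.
  by apply: hits_ge_dense => //; lia.
set B := edge_at C' @: A; pose q := m %/ N.
pose G := complete_hypergraph V 2 :\: B.
have edge2 p : edge_at C p \in complete_hypergraph V 2.
  by rewrite inE card_edge_at //; lia.
have subB : B \subset complete_hypergraph V 2.
  by apply/subsetP => _ /imsetP[p _ ->]; rewrite edgeE.
(* [S X] and [U X] collect the positions with pair in [X], on the [N] translates and on the [m]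
   cycles in use. *)
pose S (X : {set {set V}}) : {set 'I_N * 'I_n} := [set p | edge_at C p \in X].
pose U (X : {set {set V}}) : {set 'I_m * 'I_n} := [set p | edge_at C' p \in X].
(* The arcs at these positions are distinct orientations of members of [X]. *)
have S_le X : #|S X| <= 2 * #|X|.
  apply: leq_trans (card_ordered_pairs X); rewrite -(card_imset _ injarc).
  apply/subset_leq_card/subsetP => _ /imsetP[p pS ->]; rewrite inE in pS.
  by rewrite inE; have [-> ->] := arcE p.
have U_bounds X : q * #|S X| <= #|U X| <= q.+1 * #|S X|.
  have := @card_reindexed N m n c q (S X) (card_residue_class m).
  by congr (_ <= _ <= _); apply: eq_card => p; rewrite !inE edgeE.
have card_grid x y : #|{: 'I_x * 'I_y}| = x * y by rewrite card_prod !card_ord.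
have SBG : #|S B| + #|S G| = N * n.
  rewrite -card_grid -(cardsC (S B)).
  congr (_ + _); apply: eq_card => p.
  by have := edge2 p; rewrite !inE => ->; rewrite andbT.
have UBG : #|U B| + #|U G| = m * n.
  rewrite -card_grid -(cardsC (U B)).
  congr (_ + _); apply: eq_card => p.
  by have := edge2 (c p.1, p.2); rewrite !inE edgeE => ->; rewrite andbT.
have BG : #|B| + #|G| = 'C(n, 2).
  have := cardsID B (complete_hypergraph V 2).
  by rewrite (setIidPr subB) card_draws cardV.
have AB : #|A| <= #|U B|.
  by apply/subset_leq_card/subsetP => p pA; rewrite inE imset_f.
have M2 : 2 * 'C(n, 2) = N * n by rewrite double_bin2 mulnC.
have [_ UB] := andP (U_bounds B); have [UG _] := andP (U_bounds G).
(* There are twice as many positions as pairs and at most two for each pair in [B], hence at least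
   two on average in [G]. *)
have SB := S_le B; have SG : 2 * #|G| <= #|S G|.
  move: SBG BG SB; rewrite -M2.
  move: #|S B| #|S G| #|B| #|G| 'C(n, 2); lia.
have qm : q * N <= m by apply: leq_divM.
have mq : m < q.+1 * N by apply: ltn_ceil.
(* The bounds on ['C(n, k)] are [q * N <= m < q.+1 * N] multiplied by [n], since
   [N * n = 2 * 'C(n, 2)]. *)
apply: (@hits_ge_sparse V k B q); rewrite ?cardV //.
- by rewrite mulnAC M2 -mn -mulnA (mulnC n) mulnA (mulnC N) leq_mul2r qm orbT.
- rewrite mulnAC M2 -mn -mulnA (mulnC n) mulnA (mulnC N) leq_mul2r.
  by rewrite (ltnW mq) orbT.
- apply: leq_trans AB (leq_trans UB _).
  by rewrite -mulnA mulnCA leq_mul2l SB orbT.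
(* [A] lies in [U B], and the remaining positions [U G] number at least [2 * q * #|G|]. *)
rewrite -mn -UBG leq_add //; apply: leq_trans UG.
by rewrite -mulnA mulnCA leq_mul2l SG orbT.
Qed.
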